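(* Let $\Xi\subset\mathbb{R}^N$ be compact, convex, with non-empty interior, and suppose Assumptions 1 and 2 (stated in the context) hold. Let $(\Omega_i)_{i}$ be any sequence of pole-sets of $\Xi$ such that $\lim_{i\to\infty}d(\Omega_i,\Xi)=0$. Then $$\Pi_\Xi(I,\Omega_i)\ \ge\ \Pi_\Xi(I,\operatorname{ext}(\Xi))\ \text{ for all } i\qquad\text{and}\qquad \lim_{i\to\infty}\Pi_\Xi(I,\Omega_i)=\Pi_\Xi(I,\operatorname{ext}(\Xi)).$$ Moreover, the corresponding sets $\Xi'_{z_{\Omega_i}}$ satisfy $$\Pi_{\Xi'_{z_{\Omega_i}}}\!\big(I,\operatorname{ext}(\Xi'_{z_{\Omega_i}})\big)\ \le\ \Pi_\Xi(I,\operatorname{ext}(\Xi))\ \text{ for all } i\qquad\text{and}\qquad \lim_{i\to\infty}\Pi_{\Xi'_{z_{\Omega_i}}}\!\big(I,\operatorname{ext}(\Xi'_{z_{\Omega_i}})\big)=\Pi_\Xi(I,\operatorname{ext}(\Xi)).$$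
   Context: Setting: $m,n,q\ge 1$ are integers, $V\in\mathbb{R}^{m\times q}$ and $c\in\mathbb{R}^n$ are fixed. An uncertain parameter is $\xi\equiv[U_\xi,b_\xi]$ with $U_\xi\in\mathbb{R}^{m\times n}$, $b_\xi\in\mathbb{R}^m$, identified with a vector of $\mathbb{R}^N$, $N=m(n+1)$, with Euclidean norm $\|\cdot\|_2$. Vector inequalities are componentwise; $\mathbf 1$ is the all-ones vector; optimal values are infima in $[-\infty,+\infty]$. FARC for a compact convex set $X\subset\mathbb{R}^N$: minimize $c^Tu$ over $u\in\mathbb{R}^n$ and arbitrary functions $v:X\to\mathbb{R}^q$ subject to $U_\xi u+Vv(\xi)\le b_\xi$ for all $\xi\in X$. Its optimal value is denoted $\Pi_X(I,\operatorname{ext}(X))$. A pole-set of $\Xi$ is a finite set $\Omega\subset\mathbb{R}^N$ with $\Xi\subseteq\operatorname{conv}\Omega$. For $\xi\in\Xi$, $\Lambda_\xi=\{\lambda\in\mathbb{R}^\Omega_{\ge0}:\sum_\omega\lambda_\omega\omega=\xi,\ \sum_\omega\lambda_\omega=1\}$. The multipolar robust value $\Pi_\Xi(I,\Omega)$ is the optimal value of the problem: minimize $c^Tu$ over $u\in\mathbb{R}^n$, $v_\omega\in\mathbb{R}^q$ ($\omega\in\Omega$) subject to $U_\xi u+V\sum_\omega\lambda_\omega v_\omega\le b_\xi$ for all $\xi\in\Xi$, $\lambda\in\Lambda_\xi$. $d(\Omega,\Xi)=\max_{\omega\in\Omega}\min_{\xi\in\Xi}\|\omega-\xi\|_2$.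 For a pole-set $\Omega$ and $\omega\in\Omega$, $z_\omega$ is the Euclidean projection of $\omega$ on $\Xi$, and $\Xi'_{z_\Omega}=\operatorname{conv}\{z_\omega:\omega\in\Omega\}\subseteq\Xi$. Assumption 1: for every pole-set $\Omega$ of $\Xi$, the FARC problem for $\Xi'_{z_\Omega}$ has an optimal solution, and there is a constant $\mu$ (independent of $\Omega$) such that $\|(u^*,1)\|_2\le\mu$ for every pole-set $\Omega$ of $\Xi$ and every first-stage part $u^*\in\mathbb{R}^n$ of an optimal solution of the FARC problem for $\Xi'_{z_\Omega}$. Assumption 2: for some $\delta>0$, with $\Xi_\delta=\{[U,b]:\exists\,[U,b']\in\Xi,\ \|b-b'\|_\infty\le\delta\}$, there exists a static robust solution with respect to $\Xi_\delta$, i.e. $(u_\delta,v_\delta)\in\mathbb{R}^n\times\mathbb{R}^q$ with $Uu_\delta+Vv_\delta\le b$ for all $[U,b]\in\Xi_\delta$. *)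

(* Defs.v *)
From HB Require Import structures.
From mathcomp Require Import all_boot all_order all_algebra finmap.
From mathcomp Require Import all_classical all_reals all_analysis.

Set Implicit Arguments.
Unset Strict Implicit.
Unset Printing Implicit Defensive.

Import Order.TTheory GRing.Theory Num.Theory.
Import numFieldNormedType.Exports.

Local Open Scope classical_set_scope.
Local Open Scope ring_scope.

(* An uncertain parameter xi = [U, b] is the m x (n + 1)
   matrix [row_mx U b]; R^N with N = m (n + 1) is the space of such matrices,
   whose library topology is the usual product topology. *)

Definition Umx (R : realType) (m n : nat) (xi : 'M[R]_(m, (n + 1)%N)) :
  'M[R]_(m, n) := lsubmx xi.

Definition bvec (R : realType) (m n : nat) (xi : 'M[R]_(m, (n + 1)%N)) :
  'cV[R]_m := rsubmx xi.

(* The Euclidean norm of the vector of entries. The library norm [`|A|] on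
   matrices is the maximum norm instead. *)
Definition enorm (R : realType) (m n : nat) (A : 'M[R]_(m, n)) : R :=
  Num.sqrt (\sum_i \sum_j A i j ^+ 2).

Definition vle (R : realType) (m : nat) (x y : 'cV[R]_m) : Prop :=
  forall i, x i 0 <= y i 0.

Definition cost (R : realType) (n : nat) (c u : 'cV[R]_n) : R :=
  (c^T *m u) 0 0.

Section Farc.
Context (R : realType) (m n q : nat) (V : 'M[R]_(m, q)) (c : 'cV[R]_n).
Implicit Type X : set 'M[R]_(m, (n + 1)%N).

(* [v : X -> _] is an arbitrary function on the set X (seen as a subtype). *)
Definition farc_feasible X (u : 'cV[R]_n) (v : X -> 'cV[R]_q) : Prop :=
  forall xi : X, vle (Umx (val xi) *m u + V *m v xi) (bvec (val xi)).

Arguments farc_feasible X u v : clear implicits.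

Definition farc_optimal X (u : 'cV[R]_n) (v : X -> 'cV[R]_q) : Prop :=
  farc_feasible X u v /\
  forall (u' : 'cV[R]_n) (v' : X -> 'cV[R]_q),
    farc_feasible X u' v' -> cost c u <= cost c u'.

(* Pi_X(I, ext X) *)
Definition farc_value X : \bar R :=
  ereal_inf [set (cost c u)%:E | u in
    [set u | exists v : X -> 'cV[R]_q, farc_feasible X u v]].

End Farc.

Arguments farc_feasible {R m n q} V X u v.
Arguments farc_optimal {R m n q} V c X u v.

(* The coefficients lambda writing xi as a convex combination of Omega,
   i.e. lambda \in Lambda_xi. *)
Definition Lambda (R : realType) (m n : nat)
    (Omega : {fset 'M[R]_(m, (n + 1)%N)}) (xi : 'M[R]_(m, (n + 1)%N)) :
  set (Omega -> R) :=
  [set lambda : Omega -> R |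
    [/\ forall w : Omega, 0 <= lambda w,
        \sum_(w : Omega) lambda w *: fsval w = xi &
        \sum_(w : Omega) lambda w = 1]].

Arguments Lambda {R m n} Omega xi _.

Definition fin_hull (R : realType) (m n : nat)
    (Omega : {fset 'M[R]_(m, (n + 1)%N)}) : set 'M[R]_(m, (n + 1)%N) :=
  [set xi | exists lambda : Omega -> R, Lambda Omega xi lambda].

Section Multipolar.
Context (R : realType) (m n q : nat) (V : 'M[R]_(m, q)) (c : 'cV[R]_n).
Context (Xi : set 'M[R]_(m, (n + 1)%N)).
Implicit Type Omega : {fset 'M[R]_(m, (n + 1)%N)}.

Definition pole_set Omega : Prop := Xi `<=` fin_hull Omega.

Definition multipolar_feasible Omega (u : 'cV[R]_n)
    (v : Omega -> 'cV[R]_q) : Prop :=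
  forall xi (lambda : Omega -> R), Xi xi -> Lambda Omega xi lambda ->
    vle (Umx xi *m u + V *m (\sum_(w : Omega) lambda w *: v w)) (bvec xi).

Arguments multipolar_feasible Omega u v : clear implicits.

(* Pi_Xi(I, Omega) *)
Definition multipolar_value Omega : \bar R :=
  ereal_inf [set (cost c u)%:E | u in
    [set u | exists v : Omega -> 'cV[R]_q, multipolar_feasible Omega u v]].

(* The inner minimum is attained when Xi is compact and non-empty; the neutral
   element 0 of the outer maximum is harmless, distances being nonnegative. *)
Definition pole_dist Omega : R :=
  \big[Num.max/0]_(w : Omega) inf [set enorm (fsval w - xi) | xi in Xi].

(* The Euclidean projection on Xi; the nearest point exists and is unique when
   Xi is non-empty, closed and convex. *)
Definition euclid_proj (w : 'M[R]_(m, (n + 1)%N)) : 'M[R]_(m, (n + 1)%N) :=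
  xget w [set z | Xi z /\ forall xi, Xi xi -> enorm (w - z) <= enorm (w - xi)].

(* Xi'_{z_Omega} *)
Definition proj_hull Omega : set 'M[R]_(m, (n + 1)%N) :=
  fin_hull [fset euclid_proj w | w in Omega]%fset.

Definition assumption1 : Prop :=
  (forall Omega, pole_set Omega ->
     exists (u : 'cV[R]_n) (v : proj_hull Omega -> 'cV[R]_q),
       farc_optimal V c (proj_hull Omega) u v) /\
  (exists mu : R, forall Omega, pole_set Omega ->
     forall (u : 'cV[R]_n) (v : proj_hull Omega -> 'cV[R]_q),
       farc_optimal V c (proj_hull Omega) u v -> enorm (col_mx u (1%:M : 'cV[R]_1)) <= mu).

(* Xi_delta *)
Definition enlarge (delta : R) : set 'M[R]_(m, (n + 1)%N) :=
  [set xi | exists2 xi', Xi xi' &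
     Umx xi = Umx xi' /\ `|bvec xi - bvec xi'| <= delta].

Definition assumption2 : Prop :=
  exists delta : R, 0 < delta /\
  exists (u : 'cV[R]_n) (v : 'cV[R]_q),
    forall xi, enlarge delta xi -> vle (Umx xi *m u + V *m v) (bvec xi).

End Multipolar.

Arguments multipolar_feasible {R m n q} V Xi Omega u v.

(* Main.v *)
(* Let (u, v) be optimal on the hull of the projections z_w. Giving the pole w
   the decision v(z_w) violates the multipolar constraints by at most a multiple
   of the pole distance d, since xi - sum_w lambda_w z_w is a convex combination
   of the vectors w - z_w and (u, 1) is bounded by mu. Mixing in a small weight
   t = O(d) of the static solution, which has slack delta on Xi, restores
   feasibility. So the multipolar value exceeds the value on the projected hull
   by O(d), while the value on Xi lies between the two. *)
Require Import Defs.
From HB Require Import structures.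
From mathcomp Require Import all_boot all_order all_algebra finmap.
From mathcomp Require Import all_classical all_reals all_analysis.
From mathcomp Require Import ring lra.

Set Implicit Arguments.
Unset Strict Implicit.
Unset Printing Implicit Defensive.

Import Order.TTheory GRing.Theory Num.Theory.
Import numFieldNormedType.Exports.
Local Open Scope classical_set_scope.
Local Open Scope ring_scope.

(** * Finite convex combinations and hulls *)

Lemma convex_set_sum (R : realType) (E : lmodType R) (A : set E)
    (I : finType) (l : I -> R) (f : I -> E) :
  @convex_set R E A -> (forall i, 0 <= l i) -> \sum_i l i = 1 ->
  (forall i, A (f i)) -> A (\sum_i l i *: f i).
Proof.
move=> cA l0 l1 Af.
(* Binary convexity is stated with weights of an interval type; here it is restated for a plain real
   weight. *)
have A2 (t : R) x y : 0 <= t <= 1 -> A x -> A y -> A (t *: x + (1 - t) *: y).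
  move=> /andP[t0 t1] Ax Ay.
  have itv : Itv.spec (@Itv.num_sem R) (Itv.Real `[0%Z, 1%Z]) t.
    by rewrite /= /Itv.num_sem num_real /= in_itv /= t0 t1.
  by have := cA x y (Itv.mk itv) (mem_set Ax) (mem_set Ay); rewrite inE.
(* Partial weights do not sum to 1, so the induction runs on normalized partial sums, which make
   sense once some weight is positive. *)
have key (s : seq I) : 0 < \sum_(i <- s) l i ->
    A ((\sum_(i <- s) l i)^-1 *: \sum_(i <- s) l i *: f i).
  elim: s => [|i s IH] /=; first by rewrite big_nil ltxx.
  rewrite !big_cons; set L := \sum_(j <- s) l j; set S := \sum_(j <- s) _.
  have L0 : 0 <= L by rewrite sumr_ge0.
  (* If the tail has total weight 0, all its weights vanish and only [f i] remains. Otherwise the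
     normalized sum lies between [f i] and the normalized tail. *)
  have [LE|Ln] := eqVneq L 0.
    have -> : S = 0.
      rewrite /S big_seq big1// => j js.
      have /allP/(_ _ js) : all (fun i => true ==> (l i == 0)) s.
        by rewrite -psumr_eq0// -/L LE.
      by move=> /= /eqP ->; rewrite scale0r.
    rewrite LE !addr0 => li0.
    by rewrite scalerA mulVf ?gt_eqF// scale1r.
  move=> li0; have Lp : 0 < L by rewrite lt_def Ln L0.
  have -> : (l i + L)^-1 *: (l i *: f i + S) =
     (l i / (l i + L)) *: f i + (1 - l i / (l i + L)) *: (L^-1 *: S).
    rewrite scalerDr !scalerA; congr (_ *: _ + _ *: _); first by rewrite mulrC.
    by field; rewrite !gt_eqF.
  apply: A2; [|exact: Af|exact: IH].
  by apply/andP; rewrite ler_pdivrMr// mul1r lerDl L0 divr_ge0// ltW.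
by have := key (index_enum I); rewrite l1 invr1 scale1r; apply.
Qed.

Lemma fin_hull_sub (R : realType) (m n : nat)
    (Omega : {fset 'M[R]_(m, (n + 1)%N)}) (X : set 'M[R]_(m, (n + 1)%N)) :
  convex_set X -> (forall w, w \in Omega -> X w) -> fin_hull Omega `<=` X.
Proof.
move=> cX OX xi [l [l0 <- l1]]; apply: convex_set_sum => // w.
exact: OX (fsvalP w).
Qed.

Lemma sub_fin_hull (R : realType) (m n : nat)
    (Omega : {fset 'M[R]_(m, (n + 1)%N)}) w :
  w \in Omega -> fin_hull Omega w.
Proof.
move=> wO; exists (fun w' => (w' == [` wO]%fset)%:R); split.
- by move=> w'; rewrite ler0n.
- rewrite (bigD1 [` wO]%fset)//= eqxx scale1r big1 ?addr0// => w' /negPf ->.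
  by rewrite scale0r.
- by rewrite (bigD1 [` wO]%fset)//= eqxx big1 ?addr0// => w' /negPf ->.
Qed.

(** * Entry bounds and continuity for the Euclidean norm *)

Section EuclideanNorm.
Context (R : realType) (m n : nat).
Implicit Type A : 'M[R]_(m, n).

Lemma enorm_ge0 A : 0 <= enorm A.
Proof. exact: sqrtr_ge0. Qed.

Lemma ler_entry_enorm A i j : `|A i j| <= enorm A.
Proof.
rewrite -sqrtr_sqr ler_wsqrtr//.
have sq0 (k : 'I_m) : 0 <= \sum_l A k l ^+ 2.
  by apply: sumr_ge0 => l _; exact: sqr_ge0.
rewrite (bigD1 i)//= (bigD1 j)//= -addrA lerDl addr_ge0//.
  by apply: sumr_ge0 => l _; exact: sqr_ge0.
exact: sumr_ge0.
Qed.

Lemma enorm_continuous : continuous (@enorm R m n).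
Proof.
move=> A.
have sq : continuous (fun B : 'M[R]_(m, n) => \sum_i \sum_j B i j ^+ 2).
  apply: continuous_big => [|i _]; first exact: add_continuous.
  apply: continuous_big => [|j _ B]; first exact: add_continuous.
  apply: (@continuous_comp _ _ _ (fun B : 'M[R]_(m, n) => B i j) (fun x => x ^+ 2)).
    exact: coord_continuous.
  exact: exprn_continuous.
by apply: (continuous_comp (sq A)); exact: sqrt_continuous.
Qed.

End EuclideanNorm.

(** * Nearest points and the pole distance *)

Section Projection.
Context (R : realType) (m n : nat) (Xi : set 'M[R]_(m, (n + 1)%N)).
Hypotheses (cptXi : compact Xi) (Xi0 : Xi !=set0).

Lemma euclid_projP w : Xi (euclid_proj Xi w) /\
  forall xi, Xi xi -> enorm (w - euclid_proj Xi w) <= enorm (w - xi).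
Proof.
(* [xget] falls back on [w] if there is no nearest point; the extreme value theorem on the compact
   [Xi] excludes that case. *)
rewrite /euclid_proj; case: xgetP => [z _ //|none]; exfalso.
have cf : {within Xi, continuous (fun xi => enorm (w - xi))}.
  apply: continuous_subspaceT => xi.
  have sub : {for xi, continuous (fun x : 'M[R]_(m, (n + 1)%N) => w - x)}.
    by apply: continuousB; [exact: cst_continuous|move=> ?; exact: cvg_id].
  by apply: (continuous_comp sub); exact: enorm_continuous.
have [z /set_mem Xz zmin] := compact_EVT_min Xi0 cptXi cf.
by apply: (none z); split => // xi Xxi; exact/zmin/mem_set.
Qed.

Lemma enorm_proj_pole_dist (Omega : {fset 'M[R]_(m, (n + 1)%N)}) w :
  w \in Omega -> enorm (w - euclid_proj Xi w) <= pole_dist Xi Omega.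
Proof.
move=> wO; have [Xz zmin] := euclid_projP w.
apply: (@le_trans _ _ (inf [set enorm (w - xi) | xi in Xi])).
  apply: lb_le_inf => [|_ [xi Xxi <-]]; last exact: zmin.
  by exists (enorm (w - euclid_proj Xi w)), (euclid_proj Xi w).
rewrite /pole_dist.
exact: (@le_bigmax _ _ _ _
  (fun w : Omega => inf [set enorm (fsval w - xi) | xi in Xi]) [` wO]%fset).
Qed.

End Projection.

Lemma proj_hull_sub (R : realType) (m n : nat) (Xi : set 'M[R]_(m, (n + 1)%N))
    (Omega : {fset 'M[R]_(m, (n + 1)%N)}) :
  compact Xi -> Xi !=set0 -> convex_set Xi -> proj_hull Xi Omega `<=` Xi.
Proof.
move=> cptXi Xi0 cXi; apply: fin_hull_sub => // _ /imfsetP[/= w _ ->].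
by have [] := euclid_projP cptXi Xi0 w.
Qed.

(* With (u, -1) as a column, U u - b is the product xi (u, -1). *)
Definition homog {R : realType} {n : nat} (u : 'cV[R]_n) : 'cV[R]_(n + 1) :=
  col_mx u (- 1%:M).

(** * Homogenized constraints, repair of feasibility, comparison of values *)

Section Constraints.
Context (R : realType) (m n q : nat) (V : 'M[R]_(m, q)) (c : 'cV[R]_n).
Implicit Types (xi : 'M[R]_(m, (n + 1)%N)) (Omega : {fset 'M[R]_(m, (n + 1)%N)}).

Lemma vle_homog xi u v :
  vle (Umx xi *m u + V *m v) (bvec xi) <->
  forall i, (xi *m homog u + V *m v) i 0 <= 0.
Proof.
have E : xi *m homog u + V *m v = Umx xi *m u + V *m v - bvec xi.
  rewrite -{1}(hsubmxK xi) /homog mul_row_col mulmxN mulmx1.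
  exact: addrAC.
by split=> H i; have := H i; rewrite E !mxE subr_le0.
Qed.

(** The weights sum to 1, so the last entry -1 is preserved. *)
Lemma homog_conv (t : R) (u u' : 'cV[R]_n) :
  homog ((1 - t) *: u + t *: u') = (1 - t) *: homog u + t *: homog u'.
Proof.
rewrite /homog !scale_col_mx add_col_mx; congr col_mx.
by rewrite -scalerDl subrK scale1r.
Qed.

(** Changing the sign of the last entry keeps its absolute value, so the bound of [assumption1] on
    (u, 1) controls every entry of [homog u]. *)
Lemma ler_homog_enorm (u : 'cV[R]_n) j :
  `|homog u j 0| <= enorm (col_mx u (1%:M : 'cV[R]_1)).
Proof.
have -> : `|homog u j 0| = `|col_mx u (1%:M : 'cV[R]_1) j 0|.
  by rewrite /homog !mxE; case: (fintype.split j) => k //; rewrite !mxE normrN.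
exact: ler_entry_enorm.
Qed.

Lemma cost_conv (t : R) (u u' : 'cV[R]_n) :
  cost c ((1 - t) *: u + t *: u') = (1 - t) * cost c u + t * cost c u'.
Proof. by rewrite /cost mulmxDr -!scalemxAr !mxE. Qed.

Lemma ler_norm_cost (u : 'cV[R]_n) :
  `|cost c u| <= (\sum_i `|c i 0|) * enorm (col_mx u (1%:M : 'cV[R]_1)).
Proof.
rewrite /cost mxE (le_trans (ler_norm_sum _ _ _))// mulr_suml.
apply: ler_sum => i _; rewrite mxE normrM ler_wpM2l//.
have := ler_entry_enorm (col_mx u (1%:M : 'cV[R]_1)) (lshift 1 i) 0.
by rewrite col_mxEu.
Qed.

(** The static solution stays feasible when every entry of b is lowered by [delta], hence it has
    that much slack at the original parameter. *)
Lemma assumption2_slack (Xi : set 'M[R]_(m, (n + 1)%N)) :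
  assumption2 V Xi -> exists delta : R, 0 < delta /\
  exists (u : 'cV[R]_n) (v : 'cV[R]_q),
    forall xi, Xi xi -> forall i, (xi *m homog u + V *m v) i 0 <= - delta.
Proof.
move=> [d [d0 [u [v H]]]]; exists d; split => //; exists u, v => xi Xxi i.
pose xi' : 'M[R]_(m, (n + 1)%N) := row_mx (Umx xi) (bvec xi - const_mx d).
have /H/(_ i) : enlarge Xi d xi'.
  exists xi => //; rewrite /Umx /bvec row_mxKl row_mxKr; split => //.
  rewrite addrAC subrr add0r normrN.
  rewrite /Num.norm/= mx_normrE; apply: bigmax_le => [|ij _]; first exact: ltW.
  by rewrite mxE ger0_norm// ltW.
rewrite /xi' /Umx /bvec row_mxKl row_mxKr => Hi.
rewrite -{1}(hsubmxK xi) /homog mul_row_col mulmxN mulmx1.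
by move: Hi; rewrite !mxE; lra.
Qed.

(** Each row of the mixed constraint is at most (1 - t) times the violation caused by replacing
    poles [w] by points [z w], minus t times the static slack; the last hypothesis makes this
    nonpositive. *)
Lemma multipolar_feasible_conv (Xi : set 'M[R]_(m, (n + 1)%N)) Omega
    (z : Omega -> 'M[R]_(m, (n + 1)%N)) (u u' : 'cV[R]_n)
    (v : Omega -> 'cV[R]_q) (v' : 'cV[R]_q) (d mu delta t : R) :
  (forall w, vle (Umx (z w) *m u + V *m v w) (bvec (z w))) ->
  (forall w i j, `|(fsval w - z w) i j| <= d) ->
  (forall j, `|homog u j 0| <= mu) ->
  (forall xi, Xi xi -> forall i, (xi *m homog u' + V *m v') i 0 <= - delta) ->
  0 <= t <= 1 -> (1 - t) * (d * mu *+ (n + 1)) <= t * delta ->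
  multipolar_feasible V Xi Omega ((1 - t) *: u + t *: u')
    (fun w => (1 - t) *: v w + t *: v').
Proof.
move=> zuv dz umu uv' /andP[t0 t1] tdelta xi l Xxi [l0 lxi l1].
apply/vle_homog => i; rewrite homog_conv.
(* [S] averages the constraints satisfied at the points [z w], and [D] is the error [xi] minus the
   same average of the [z w]; the constraint at [xi] is [S + D *m homog u]. *)
pose S := \sum_(w : Omega) l w *: (z w *m homog u + V *m v w).
pose D := \sum_(w : Omega) l w *: (fsval w - z w).
have -> : xi *m ((1 - t) *: homog u + t *: homog u') +
    V *m (\sum_(w : Omega) l w *: ((1 - t) *: v w + t *: v')) =
    (1 - t) *: (S + D *m homog u) + t *: (xi *m homog u' + V *m v').
  have -> : S + D *m homog u =
      xi *m homog u + V *m (\sum_(w : Omega) l w *: v w).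
    rewrite /S /D -lxi !mulmx_suml mulmx_sumr -!big_split/=.
    apply: eq_bigr => w _.
    rewrite -!scalemxAl -scalemxAr -!scalerDr mulmxBl.
    by rewrite addrAC addrCA subrr addr0 addrC.
  have -> : \sum_(w : Omega) l w *: ((1 - t) *: v w + t *: v') =
      (1 - t) *: (\sum_(w : Omega) l w *: v w) + t *: v'.
    rewrite scaler_sumr -[X in _ = _ + X]scale1r -l1 scaler_suml -big_split/=.
    by apply: eq_bigr => w _; rewrite scalerDr !scalerA (mulrC (l w)).
  by rewrite !mulmxDr -!scalemxAr !scalerDr addrACA.
have S0 : S i 0 <= 0.
  rewrite summxE -oppr_ge0 -sumrN; apply: sumr_ge0 => w _.
  by rewrite mxE -mulrN mulr_ge0// oppr_ge0; move: i; exact/vle_homog.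
have Dd j : `|D i j| <= d.
  rewrite summxE (le_trans (ler_norm_sum _ _ _))// -[leRHS]mul1r -l1 mulr_suml.
  by apply: ler_sum => w _; rewrite mxE normrM ger0_norm// ler_wpM2l.
(* The factor n + 1 counts the entries of [homog u]: each product in the row is bounded by [d * mu]
   separately. *)
have Du : (D *m homog u) i 0 <= d * mu *+ (n + 1).
  rewrite mxE (le_trans (ler_norm _))// (le_trans (ler_norm_sum _ _ _))//.
  rewrite -[X in _ *+ X](card_ord (n + 1)) -sumr_const.
  by apply: ler_sum => j _; rewrite normrM ler_pM.
have entry (x y : R) (A B C : 'cV[R]_m) :
    (x *: (A + B) + y *: C) i 0 = x * (A i 0 + B i 0) + y * C i 0.
  by rewrite !mxE.
have slack := uv' _ Xxi i; rewrite entry.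
apply: le_trans (_ : (1 - t) * (d * mu *+ (n + 1)) + t * (- delta) <= 0).
  by apply: lerD; apply: ler_wpM2l; rewrite ?subr_ge0// -[leRHS]add0r lerD.
by rewrite mulrN subr_le0.
Qed.

Lemma farc_value_optimal (X : set 'M[R]_(m, (n + 1)%N)) u v :
  farc_optimal V c X u v -> farc_value V c X = (cost c u)%:E.
Proof.
move=> [uv umin]; apply/eqP; rewrite eq_le; apply/andP; split.
  by apply: ereal_inf_lbound; exists u => //; exists v.
apply: le_ereal_inf_tmp => _ [u' [v' uv'] <-].
by rewrite lee_fin; exact: umin uv'.
Qed.

Lemma farc_value_sub (X Y : set 'M[R]_(m, (n + 1)%N)) :
  X `<=` Y -> (farc_value V c X <= farc_value V c Y)%E.
Proof.
move=> XY; apply: ereal_inf_le_tmp => _ [u [v uv] <-]; exists u => //.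
have toY (x : X) : Y (val x) by apply/XY/set_mem; exact: valP.
exists (fun x => v (SigSub (mem_set (toY x)))) => x.
exact: (uv (SigSub (mem_set (toY x)))).
Qed.

(** Choosing one [lambda] for each parameter and interpolating the pole decisions gives a recourse
    function on [Xi] with the same first stage. *)
Lemma farc_le_multipolar (Xi : set 'M[R]_(m, (n + 1)%N)) Omega :
  pole_set Xi Omega -> (farc_value V c Xi <= multipolar_value V c Xi Omega)%E.
Proof.
move=> XO; apply: ereal_inf_le_tmp => _ [u [v uv] <-]; exists u => //.
have /choice[l lP] : forall x : Xi, exists l, Lambda Omega (val x) l.
  by move=> x; apply/XO/set_mem; exact: valP.
exists (fun x => \sum_(w : Omega) l x w *: v w) => x.
by apply: uv (lP x); apply/set_mem; exact: valP.
Qed.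

Lemma multipolar_value_le_proj (Xi : set 'M[R]_(m, (n + 1)%N)) :
  compact Xi -> Xi !=set0 -> assumption1 V c Xi -> assumption2 V Xi ->
  exists B : R, forall Omega, pole_set Xi Omega -> exists F : R,
    farc_value V c (proj_hull Xi Omega) = F%:E /\
    (multipolar_value V c Xi Omega <= (F + B * pole_dist Xi Omega)%:E)%E.
Proof.
move=> cptXi Xi0 [opt [mu mubound]].
move=> /assumption2_slack[delta [delta0 [u' [v' uv']]]].
pose G := \sum_i `|c i 0|.
(* The first factor bounds t per unit of pole distance; the second bounds the cost gap between [u']
   and any optimal [u], whose cost is at most [G * mu] in absolute value. Nothing here depends on
   the pole-set. *)
exists (mu *+ (n + 1) / delta * (`|cost c u'| + G * mu)) => Omega XO.
have [u [v uv]] := opt _ XO; exists (cost c u); split.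
  exact: farc_value_optimal uv.
have umu := mubound _ XO _ _ uv.
have mu0 : 0 <= mu by exact: le_trans (enorm_ge0 _) umu.
set d := pole_dist Xi Omega.
have d0 : 0 <= d by exact: bigmax_ge_id.
have zP (w : Omega) : proj_hull Xi Omega (euclid_proj Xi (fsval w)).
  by apply: sub_fin_hull; apply/imfsetP; exists (fsval w) => //; exact: fsvalP.
pose vz (w : Omega) := v (SigSub (mem_set (zP w))).
pose e := d * mu *+ (n + 1).
have e0 : 0 <= e by rewrite mulrn_wge0// mulr_ge0.
have de0 : 0 < delta + e by rewrite ltr_wpDr.
(* The weight t makes the violation (1 - t) e equal to the slack t delta. *)
have [t [t01 te t_le]] : exists t : R, [/\ 0 <= t <= 1,
    (1 - t) * e = t * delta & t <= mu *+ (n + 1) / delta * d].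
  exists (e / (delta + e)); split.
  - by rewrite divr_ge0 ?(ltW de0)//= ler_pdivrMr// mul1r lerDr ltW.
  - by move: (e) de0 => x x0; field; rewrite gt_eqF.
  (* The right side is [e / delta], obtained from t by dropping [e] from the denominator. *)
  - rewrite mulrAC [_ *+ _ * d]mulrnAl [mu * d]mulrC -/e.
    by apply: ler_wpM2l; rewrite ?lef_pV2 ?posrE// lerDl.
have feas : multipolar_feasible V Xi Omega ((1 - t) *: u + t *: u')
    (fun w => (1 - t) *: vz w + t *: v').
  apply: (multipolar_feasible_conv (z := fun w => euclid_proj Xi (fsval w))
    (d := d) (mu := mu) (delta := delta)) => //.
  - by move=> w; have [feas _] := uv; exact: feas (SigSub (mem_set (zP w))).
  - move=> w i j; apply: le_trans (ler_entry_enorm _ i j) _.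
    exact: enorm_proj_pole_dist (fsvalP w).
  - by move=> j; exact: le_trans (ler_homog_enorm u j) umu.
  - by rewrite te.
apply: (@le_trans _ _ (cost c ((1 - t) *: u + t *: u'))%:E).
  apply: ereal_inf_lbound; exists ((1 - t) *: u + t *: u') => //.
  by exists (fun w => (1 - t) *: vz w + t *: v').
(* The mixture costs [cost c u] plus t times the gap [cost c u' - cost c u], so it remains to bound
   that second term. *)
rewrite lee_fin cost_conv mulrBl mul1r -addrA lerD2l addrC -mulrBr.
have [t0 _] := andP t01.
rewrite mulrAC; apply: (@le_trans _ _ (t * `|cost c u' - cost c u|)).
  by apply: ler_wpM2l => //; exact: ler_norm.
apply: ler_pM => //; apply: le_trans (ler_normB _ _) _; rewrite lerD2l.
apply: le_trans (ler_norm_cost u) _.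
by apply: ler_wpM2l umu; rewrite sumr_ge0.
Qed.

End Constraints.

Theorem corollary3 (R : realType) (m n q : nat)
    (hm : (1 <= m)%N) (hn : (1 <= n)%N) (hq : (1 <= q)%N)
    (V : 'M[R]_(m, q)) (c : 'cV[R]_n)
    (Xi : set 'M[R]_(m, (n + 1)%N))
    (Xi_compact : compact Xi) (Xi_convex : convex_set Xi)
    (Xi_interior : interior Xi !=set0)
    (A1 : assumption1 V c Xi) (A2 : assumption2 V Xi)
    (Omega : nat -> {fset 'M[R]_(m, (n + 1)%N)})
    (Omega_pole : forall i, pole_set Xi (Omega i))
    (Omega_lim : pole_dist Xi (Omega i) @[i --> \oo] --> (0 : R)) :
  [/\ forall i, (farc_value V c Xi <= multipolar_value V c Xi (Omega i))%E,
      multipolar_value V c Xi (Omega i) @[i --> \oo] --> farc_value V c Xi,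
      forall i, (farc_value V c (proj_hull Xi (Omega i))
                 <= farc_value V c Xi)%E &
      farc_value V c (proj_hull Xi (Omega i)) @[i --> \oo]
        --> farc_value V c Xi].
Proof.
have Xi0 : Xi !=set0.
  by have [x xXi] := Xi_interior; exists x; exact: interior_subset xXi.
have PM i := farc_le_multipolar V c (Omega_pole i).
have FP i : (farc_value V c (proj_hull Xi (Omega i)) <= farc_value V c Xi)%E.
  by apply: farc_value_sub; apply: proj_hull_sub.
have [B BP] := multipolar_value_le_proj Xi_compact Xi0 A1 A2.
have /choice[F FE] := fun i => BP _ (Omega_pole i).
(* The value on [Xi] lies between the finite value on the projected hull and a finite upper bound of
   the multipolar value, so it is real. *)
have [p pE] : exists p : R, farc_value V c Xi = p%:E.
  have [F0 M0] := FE 0%N; have := FP 0%N; have := le_trans (PM 0%N) M0.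
  by rewrite F0; case: (farc_value V c Xi) => [r _ _| |]//; exists r.
have Mp i : (multipolar_value V c Xi (Omega i) <=
    (p + B * pole_dist Xi (Omega i))%:E)%E.
  have [Fi Mi] := FE i; apply: le_trans Mi _.
  by rewrite lee_fin lerD2r -lee_fin -Fi -pE.
(* The same estimate read backwards: [p] is at most the multipolar value, hence at most the
   projected value plus B times the distance. *)
have pF i : ((p - B * pole_dist Xi (Omega i))%:E <=
    farc_value V c (proj_hull Xi (Omega i)))%E.
  have [-> Mi] := FE i; have := le_trans (PM i) Mi.
  by rewrite pE !lee_fin lerBlDr.
have Bd : B * pole_dist Xi (Omega i) @[i --> \oo] --> 0.
  by rewrite -(mulr0 B); exact: cvgMr.
split => //; rewrite pE.
- apply: (@squeeze_cvge _ _ _ _ (cst p%:E) _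
    (fun i => (p + B * pole_dist Xi (Omega i))%:E)).
  + by apply: nearW => i; rewrite Mp/= -pE PM.
  + exact: cvg_cst.
  + apply: cvg_EFin; first exact: nearW.
    rewrite -[X in _ --> X]addr0; apply: cvgD => //; exact: cvg_cst.
- apply: (@squeeze_cvge _ _ _ _ (fun i => (p - B * pole_dist Xi (Omega i))%:E) _
    (cst p%:E)).
  + by apply: nearW => i; rewrite pF/= -pE FP.
  + apply: cvg_EFin; first exact: nearW.
    rewrite -[X in _ --> X]subr0; apply: cvgB => //; exact: cvg_cst.
  + exact: cvg_cst.
Qed.
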